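(* Let $n\ge 1$ and let $m\ge 1$ be odd. Then for any $\alpha_0,\dots,\alpha_{m-1}\in\mathbb{R}$ the initial value problem $$ \begin{cases} (-\Delta)^m u(r)=e^{u(r)}\\ u(0)=\alpha_0,\quad u'(0)=0\\ \Delta^k u(0)=\alpha_k,\quad (\Delta^k u)'(0)=0 \quad\text{for any } k\in\{1,\dots,m-1\} \end{cases} $$ admits a unique global solution, i.e. a unique solution defined for all $r\in[0,+\infty)$.
   Context: A function $u=u(r)$ of $r\ge 0$ is identified with the radial function $x\mapsto u(|x|)$ on $\mathbb{R}^n$ (for $n=1$: an even function), and $\Delta$ is the Laplacian in $\mathbb{R}^n$, i.e. $\Delta u(r)=u''(r)+\frac{n-1}{r}u'(r)$ for $r>0$. Solutions are classical, i.e. $x\mapsto u(|x|)$ is of class $C^{2m}$ (including at the origin) and satisfies $(-\Delta)^m u=e^u$. *)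

(* Defs.v *)
From mathcomp Require Import all_boot all_order all_algebra.
From mathcomp Require Import all_classical all_reals all_analysis.

Set Implicit Arguments.
Unset Strict Implicit.
Unset Printing Implicit Defensive.

Import Order.TTheory GRing.Theory Num.Theory.
Import numFieldNormedType.Exports.

Local Open Scope classical_set_scope.
Local Open Scope ring_scope.

(* The library norm on 'rV[R]_n is the sup norm, hence this definition. *)
Definition enorm (R : realType) (n : nat) (x : 'rV[R]_n) : R :=
  Num.sqrt (\sum_(i < n) x ord0 i ^+ 2).

(* x |-> u(|x|); it only depends on the values of u on [0, +oo[. *)
Definition radial (R : realType) (n : nat) (u : R -> R) : 'rV[R]_n -> R :=
  fun x => u (enorm x).

Definition partial (R : realType) (n : nat) (i : 'I_n) (F : 'rV[R]_n -> R) :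
    'rV[R]_n -> R :=
  fun x => 'D_'e_i F x.

(* The library derivative is total, so the existence of each partial
   derivative is required explicitly. *)
Fixpoint Ck (R : realType) (n : nat) (k : nat) (F : 'rV[R]_n -> R) : Prop :=
  match k with
  | 0%N => continuous F
  | k'.+1 => continuous F /\
      forall i : 'I_n, (forall x, derivable F x 'e_i) /\ Ck k' (partial i F)
  end.

Definition laplacian (R : realType) (n : nat) (F : 'rV[R]_n -> R) :
    'rV[R]_n -> R :=
  fun x => \sum_(i < n) partial i (partial i F) x.

Definition neg_laplacian (R : realType) (n : nat) (F : 'rV[R]_n -> R) :
    'rV[R]_n -> R :=
  fun x => - laplacian F x.

(* Delta^k u as a function of r: the k-th iterated Laplacian in R^n of
   x |-> u(|x|) is again radial, and r >= 0 is represented by the point r e_1.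
   For k = 0 this is u itself on [0, +oo[, see iter_lap0. *)
Definition iter_lap (R : realType) (n : nat) (hn : (1 <= n)%N) (k : nat)
    (u : R -> R) : R -> R :=
  fun r => iter k (@laplacian R n) (radial u) (r *: 'e_(Ordinal hn)).

Lemma enorm_scale_delta (R : realType) (n : nat) (i : 'I_n) (r : R) :
  enorm (r *: ('e_i : 'rV[R]_n)) = `|r|.
Proof.
rewrite /enorm (bigD1 i) //= !mxE !eqxx mulr1 big1 ?addr0 ?sqrtr_sqr //.
by move=> j /negbTE ji; rewrite !mxE ji andbF mulr0 expr0n.
Qed.

Lemma iter_lap0 (R : realType) (n : nat) (hn : (1 <= n)%N) (u : R -> R) (r : R) :
  0 <= r -> iter_lap hn 0 u r = u r.
Proof. by move=> r0; rewrite /iter_lap /radial /= enorm_scale_delta ger0_norm. Qed.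

(* g is regarded as a function on [0, +oo[, so g'(0) is one-sided. *)
Definition right_derivative0 (R : realType) (g : R -> R) (l : R) : Prop :=
  h^-1 * (g h - g 0) @[h --> 0^'+] --> l.

Record global_solution (R : realType) (n : nat) (hn : (1 <= n)%N) (m : nat)
    (alpha : 'I_m -> R) (u : R -> R) : Prop := GlobalSolution {
  sol_regular : Ck (2 * m)%N (radial u : 'rV[R]_n -> R);
  sol_equation : forall x : 'rV[R]_n,
    iter m (@neg_laplacian R n) (radial u) x = expR (radial u x);
  sol_value0 : forall k : 'I_m, iter_lap hn k u 0 = alpha k;
  sol_derivative0 : forall k : 'I_m, right_derivative0 (iter_lap hn k u) 0
}.

(* Main.v *)
Require Import Defs.
From mathcomp Require Import all_boot all_order all_algebra.
From mathcomp Require Import all_classical all_reals all_analysis.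
From mathcomp Require Import ring lra.
Import Order.TTheory GRing.Theory Num.Theory.
Import numFieldNormedType.Exports.

(** The radial Laplacian is inverted by two successive primitives: among
    functions that are regular at the origin, [Delta w = f] means that
    [w'(0) = 0] and that [r^(n-1) w'] is a primitive of [r^(n-1) f]. The
    initial value problem is therefore the integral equation
    [u = solve n s (- expR u)], where [s] lists the values [alpha_k] and
    [solve] applies [g |-> alpha_k + invlap n g] once for every [k], from the
    last one to the first.

    The sign is what makes the solution global. For odd [m] the equation reads
    [Delta^m u = - e^u < 0], and [invlap] is monotone, so every Picard iterate,
    like the solution itself, lies below the solution [P] of [Delta^m P = 0]
    with the same data ([picard_le]). On a ball of radius [rho] the exponential
    is then Lipschitz with the constant [e^C] with [C = max P], and since each
    inversion of the Laplacian gains two powers of [r] and a factor growing with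
    the exponent, the difference of the [j]-th and [j+1]-st iterates is at most
    [M (K r^2)^j / j!] ([chain_norm_le], [picard_iter_dist]). The iterates
    converge locally uniformly on all of [0, +oo[ ([picard_fixpoint]). The same
    estimate applied to the difference of two solutions bounds it by
    [M (K r^2)^j / j!] for every [j], which gives uniqueness
    ([global_solution_unique]).

    The remaining work is to pass between functions of [r] and functions
    on [R^n]. In one direction, [x |-> f |x|] has the regularity of [f] as
    a function of [r^2]: the class [smooth] asks for [f' = r f1],
    [f1' = r f2] and so on, whence [partial_i (f |x|) = x_i f1 |x|] with no
    exception at the origin ([is_derive_radial_smooth]). This class is stable
    under [invlap] and [expR], so that the continuous fixed point is in it for
    every order by bootstrap ([smooth_picard_fixpoint]). In the other direction,
    the Laplacian of any radial function of class [C^2] is radial, and its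
    profile is the radial Laplacian of the original one ([laplacian_radial_C2]). *)

Set Implicit Arguments.
Unset Strict Implicit.
Unset Printing Implicit Defensive.

Local Open Scope classical_set_scope.
Local Open Scope ring_scope.

(** * Primitives, comparison and elementary estimates *)

Section Calculus.
Context {R : realType}.
Local Notation mu := (@lebesgue_measure R).
Implicit Types f g : R -> R.

Lemma is_derive_ext (V : normedModType R) (f g : V -> R) (x v : V) (l : R) :
  f =1 g -> is_derive x v f l -> is_derive x v g l.
Proof. by move=> /funext ->. Qed.

Lemma is_derive1_continuous f (x l : R) :
  is_derive x 1 f l -> {for x, continuous f}.
Proof. by move=> d; apply/differentiable_continuous/derivable1_diffP. Qed.

(** The difference of two integrals, one of which is over an empty interval,
    is the integral from [0] to [x] for either sign of [x]. *)
Definition prim f (x : R) : R :=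
  \int[mu]_(t in `]0, x]) f t - \int[mu]_(t in `]x, 0]) f t.

Lemma prim0 f : prim f 0 = 0.
Proof. by rewrite /prim subrr. Qed.

(** On a neighbourhood of a point, a fixed lower bound [a] turns [prim f] into
    an ordinary parameterized integral up to a constant, to which the
    fundamental theorem of calculus applies. *)
Lemma primE f (a x : R) : continuous f -> a <= x -> a <= 0 ->
  prim f x = \int[mu]_(t in `[a, x]) f t - \int[mu]_(t in `[a, 0]) f t.
Proof.
move=> cf ax a0.
have int_f y z : mu.-integrable `[y, z] (EFin \o f).
  by apply: continuous_compact_integrable;
    [exact: segment_compact|exact: continuous_subspaceT].
rewrite /prim; have [x0|x0] := leP 0 x.
  rewrite (@set_itv_ge _ _ (BRight x) (BRight 0)) ?bnd_simp -?leNgt//.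
  rewrite Rintegral_set0 subr0.
  by rewrite Rintegral_itvB ?bnd_simp.
rewrite (@set_itv_ge _ _ (BRight 0) (BRight x)) ?bnd_simp -?leNgt ?ltW//.
rewrite Rintegral_set0.
by rewrite -[RHS]opprB Rintegral_itvB ?bnd_simp ?sub0r// ltW.
Qed.

Lemma is_derive_prim f (x : R) : continuous f -> is_derive x 1 (prim f) (f x).
Proof.
move=> cf; pose a := - (`|x| + 1).
have ax : a < x by rewrite /a; have := ler_norm (- x); rewrite normrN; lra.
have a0 : a < 0 by rewrite /a; have := normr_ge0 x; lra.
have int_f y z : mu.-integrable `[y, z] (EFin \o f).
  by apply: continuous_compact_integrable;
    [exact: segment_compact|exact: continuous_subspaceT].
have xx1 : x < x + 1 by rewrite ltrDl.
have [dF F'] := continuous_FTC1_closed xx1 (int_f a _) ax (cf x).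
apply: (@near_eq_is_derive _ _ _
  (fun y => \int[mu]_(t in `[a, y]) f t - \int[mu]_(t in `[a, 0]) f t)).
  near=> y; apply/esym/primE => //; last exact: ltW.
  near: y; exact: lt_le_nbhsr.
have -> : f x = f x - 0 by rewrite subr0.
by apply: is_deriveB; apply: DeriveDef => //; rewrite -derive1E.
Unshelve. all: by end_near. Qed.

Lemma continuous_prim f : continuous f -> continuous (prim f).
Proof. by move=> cf x; apply: is_derive1_continuous (is_derive_prim x cf). Qed.

Lemma le_of_derive_le (f g df dg : R -> R) (a b : R) : a <= b ->
  {within `[a, b], continuous f} -> {within `[a, b], continuous g} ->
  (forall x, a < x < b -> is_derive x 1 f (df x)) ->
  (forall x, a < x < b -> is_derive x 1 g (dg x)) ->
  (forall x, a < x < b -> df x <= dg x) ->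
  f a <= g a -> f b <= g b.
Proof.
move=> ab cf cg df_ dg_ le_df fga; move: ab.
rewrite le_eqVlt => /predU1P[<-//|ab].
have [x|c|c + fgb] := @MVT R (g - f) (fun x => dg x - df x) _ _ ab.
- by rewrite in_itv/= => xab; apply: is_deriveB; [exact: dg_|exact: df_].
- move=> x.

 apply: continuousD _; first exact: cg. apply: continuousN. exact: cf.
- rewrite in_itv/= => cab.
have : 0 <= (g - f) b - (g - f) a.
  by rewrite fgb mulr_ge0 ?subr_ge0 ?le_df// ltW.
by rewrite !fctE; lra.
Qed.

Lemma expR_lipschitz (C a b : R) : a <= C -> b <= C ->
  `|expR a - expR b| <= expR C * `|a - b|.
Proof.
wlog ab : a b / b <= a.
  move=> H aC bC; have [ba|/ltW ab] := leP b a; first exact: H.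
  by rewrite distrC [X in _ * X]distrC; exact: H.
move=> aC bC; rewrite !ger0_norm ?subr_ge0 ?ler_expR//.
have : expR a * (1 + (b - a)) <= expR a * expR (b - a).
  by rewrite ler_wpM2l ?expR_ge0// expR_ge1Dx.
rewrite -expRD [a + _]addrC subrK => h.
apply: (@le_trans _ _ (expR a * (a - b))); first by lra.
by rewrite ler_wpM2r ?subr_ge0// ler_expR.
Qed.

Lemma exp_coeffMl (x y : R) (j : nat) :
  exp_coeff (x * y) j = exp_coeff x j * y ^+ j.
Proof. by rewrite !exp_coeffE exprMn mulrA. Qed.

(** One Picard step multiplies the bound by [K] and divides it by the
    exponent [2j + 2], which is at least [j + 1]: this is how the terms of
    the exponential series arise. *)
Lemma exp_coeff_step (K : R) (j : nat) : 0 <= K ->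
  exp_coeff K j * K / (2 * j).+2%:R <= exp_coeff K j.+1.
Proof.
move=> K0; rewrite !exp_coeffE factS natrM invfM exprSr /=.
rewrite [leRHS](_ : _ = j`!%:R^-1 * K ^+ j * K / j.+1%:R); last by ring.
rewrite ler_wpM2l ?mulr_ge0 ?exprn_ge0// lef_pV2 ?posrE ?ltr0n//.
by rewrite ler_nat ltnS mul2n -addnn leqW// leq_addr.
Qed.

Lemma continuous_bounded (f : R -> R) (rho : R) : continuous f ->
  exists2 M, 0 <= M & forall r : R, 0 <= r <= rho -> `|f r| <= M.
Proof.
move=> cf; have [r0|r0] := leP 0 rho; last first.
  by exists 0 => // r /andP[/le_trans/[apply]]; rewrite leNgt r0.
have [|c _ hc] := @EVT_max R (fun r => `|f r|) 0 rho r0.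
  by apply: continuous_subspaceT => x; apply: cvg_norm; exact: cf.
by exists `|f c| => // r hr; apply: hc.
Qed.

End Calculus.

(** * Functions smooth in the square of the radius *)

Section EvenCalculus.
Context {R : realType}.
Implicit Types f g : R -> R.

(** The mean value theorem from [0] to [r] for either sign of [r]. The origin is
    exempt from the differentiability assumption, because the quotients defining
    averages are singular there. *)
Lemma MVT0 (f df : R -> R) (r : R) : continuous f ->
  (forall x : R, x != 0 -> is_derive x 1 f (df x)) -> r != 0 ->
  exists c, [/\ c != 0, `|c| <= `|r| & f r - f 0 = df c * r].
Proof.
move=> cf f' r0; case: (ltgtP r 0) r0 => // r0 _.
  have [x|x|c] := @MVT R f df r 0 r0; last first.
  - rewrite in_itv/= => /andP[rc c0] E; exists c; split; [exact: ltr0_neq0| |].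
      by rewrite !ltr0_norm ?lerN2// ltW.
    by rewrite -opprB E sub0r mulrN opprK.
  - exact: continuous_subspaceT.
  - by rewrite in_itv/= => /andP[_ x0]; exact/f'/ltr0_neq0.
have [x|x|c] := @MVT R f df 0 r r0; last first.
- rewrite in_itv/= subr0 => /andP[c0 cr] E; exists c; split => //.
    exact: lt0r_neq0.
  by rewrite !gtr0_norm// ltW.
- exact: continuous_subspaceT.
- by rewrite in_itv/= => /andP[x0 _]; exact/f'/lt0r_neq0.
Qed.

Lemma prim_unique (f df : R -> R) : continuous df ->
  (forall x : R, is_derive x 1 f (df x)) -> f 0 = 0 -> f = prim df.
Proof.
move=> cdf f' f0; apply/funext => r.
have : (f - prim df) r = (f - prim df) 0.
  apply: is_derive_0_is_cst => x; rewrite -(subrr (df x)).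
  by apply: is_deriveB; exact: is_derive_prim.
by rewrite !fctE prim0 f0 subr0 => /subr0_eq.
Qed.

(** If [f] is continuous and its derivative off the origin extends
    continuously, then [f] minus a primitive of that extension is constant,
    so that the origin is no exception. *)
Lemma is_derive_removable (f df : R -> R) : continuous f -> continuous df ->
  (forall x : R, x != 0 -> is_derive x 1 f (df x)) ->
  forall x : R, is_derive x 1 f (df x).
Proof.
move=> cf cdf f' x; suff -> : f = prim df + cst (f 0).
  by rewrite -[df x]addr0; apply: is_deriveD; exact: is_derive_prim.
apply/funext => r; have [->|r0] := eqVneq r 0; first by rewrite !fctE prim0 add0r.
have [y|y y0|c [_ _]] := @MVT0 (f - prim df) (fun=> 0) r _ _ r0.
- by apply: continuousB; [exact: cf|exact: continuous_prim].
- rewrite -(subrr (df y)); apply: is_deriveB; first exact: f'.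
  exact: is_derive_prim.
by rewrite !fctE prim0 mul0r; lra.
Qed.

Definition wprim (p : nat) f : R -> R := prim (fun t : R => t ^+ p * f t).

(** This is [int_0^1 t^p f (t r) dt], written as the quotient that results from
    the change of variable [t r]; the case [r = 0] is its continuous
    extension. *)
Definition avg (p : nat) f (r : R) : R :=
  if r == 0 then f 0 / p.+1%:R else wprim p f r / r ^+ p.+1.

Lemma continuous_mulXn (p : nat) f :
  continuous f -> continuous (fun t : R => t ^+ p * f t).
Proof. by move=> cf x; apply: cvgM; [exact: exprn_continuous|exact: cf]. Qed.

Lemma is_derive_Xn (p : nat) (r : R) :
  is_derive r 1 (fun t : R => t ^+ p) (p%:R * r ^+ p.-1).
Proof.
have := @is_deriveX R R id p r 1 1 _.
rewrite /GRing.scale/= mulr1 => h.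
by apply: is_derive_ext (h _) => t; rewrite ?fctE.
Qed.

Lemma is_derive_cXn (c : R) (p : nat) (r : R) :
  is_derive r 1 (fun t : R => c * t ^+ p) (c * (p%:R * r ^+ p.-1)).
Proof.
have := is_deriveM (@is_derive_cst R R R c r 1) (is_derive_Xn p r).
by move=> /is_derive_eq; apply; rewrite /GRing.scale/=; ring.
Qed.

Lemma continuous_cXn (c : R) (p : nat) : continuous (fun t : R => c * t ^+ p).
Proof. by move=> r; apply: is_derive1_continuous (is_derive_cXn c p r). Qed.

Lemma is_derive_wprim (p : nat) f (r : R) : continuous f ->
  is_derive r 1 (wprim p f) (r ^+ p * f r).
Proof. by move=> cf; apply/is_derive_prim/continuous_mulXn. Qed.

Lemma wprim0 p f : wprim p f 0 = 0. Proof. exact: prim0. Qed.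

Lemma avgE (p : nat) f (r : R) : r ^+ p.+1 * avg p f r = wprim p f r.
Proof.
rewrite /avg; have [->|r0] := eqVneq r 0; first by rewrite expr0n mul0r wprim0.
by rewrite mulrC divfK// expf_neq0.
Qed.

(** Cauchy's mean value theorem for [wprim p f] and [r^(p+1)]. It gives the
    continuity of the average at the origin. *)
Lemma avg_mean (p : nat) f (r : R) : continuous f ->
  exists2 c, `|c| <= `|r| & avg p f r = f c / p.+1%:R.
Proof.
move=> cf; have [->|r0] := eqVneq r 0; first by exists 0; rewrite // /avg eqxx.
(* The auxiliary function of Cauchy's mean value theorem: it vanishes at [0]
   and at [r]. *)
pose h t := wprim p f t * r ^+ p.+1 - t ^+ p.+1 * wprim p f r.
pose dh t := t ^+ p * f t * r ^+ p.+1 - p.+1%:R * t ^+ p * wprim p f r.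
have h' (x : R) : is_derive x 1 h (dh x).
  apply: is_deriveB.
    have := @is_deriveM R _ (wprim p f) (cst (r ^+ p.+1)) x 1 _ _
      (is_derive_wprim p x cf) (is_derive_cst _ _ _).
    by move=> /is_derive_eq; apply; rewrite /GRing.scale/=; ring.
  have := @is_deriveM R _ (fun t : R => t ^+ p.+1) (cst (wprim p f r)) x 1 _ _
    (is_derive_Xn p.+1 x) (is_derive_cst _ _ _).
  by move=> /is_derive_eq; apply; rewrite /GRing.scale/=; ring.
have [x|c [c0 cr]] := @MVT0 h dh r _ (fun x _ => h' x) r0.
  exact: is_derive1_continuous (h' x).
rewrite /h wprim0 mul0r [0 ^+ _]expr0n mul0r subr0 mulrC !subrr => /esym/eqP.
rewrite mulf_eq0 (negbTE r0) orbF /dh subr_eq0 => /eqP E; exists c => //.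
have rp : r ^+ p.+1 != 0 by rewrite expf_neq0.
have cp : c ^+ p != 0 by rewrite expf_neq0.
rewrite /avg (negbTE r0); apply/eqP; rewrite eqr_div// ?pnatr_eq0//.
by apply/eqP/(mulfI cp); lra.
Qed.

Lemma continuous_avg (p : nat) f : continuous f -> continuous (avg p f).
Proof.
move=> cf r; have [->|r0] := eqVneq r 0.
  apply/cvgrPdist_lt => e e0.
  have := cf 0 => /cvgrPdist_lt/(_ _ e0)[d /= d0 hd].
  exists d => //= t /=; rewrite sub0r normrN => td.
  have [c ct ->] := avg_mean p t cf.
  rewrite /avg eqxx -mulrBl normrM (@le_lt_trans _ _ `|f 0 - f c|)//.
    by rewrite ler_piMr// ger0_norm ?invr_ge0// invf_le1// ?ltr0n// ler1n.
  by apply: hd => /=; rewrite sub0r normrN (le_lt_trans ct).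
have rp : r ^+ p.+1 != 0 by rewrite expf_neq0.
have : wprim p f x * (x ^+ p.+1)^-1 @[x --> r] --> avg p f r.
  rewrite /avg (negbTE r0); exact: is_derive1_continuous
    (is_deriveM (is_derive_wprim p r cf)
      (is_deriveV (f := fun t : R => t ^+ p.+1) rp (is_derive_Xn p.+1 r))).
apply: cvg_trans; apply: near_eq_cvg; near=> t.
rewrite /avg ifF//; apply/negbTE; near: t.
by exists `|r|; rewrite /= ?normr_gt0// => t /=;
  case: eqVneq => // ->; rewrite subr0 ltxx.
Unshelve. all: by end_near. Qed.

(** Integration by parts of [t^(p+2) f1 = t^(p+1) f']. *)
Lemma wprim_by_parts (p : nat) f f1 (r : R) : continuous f1 ->
  (forall r : R, is_derive r 1 f (r * f1 r)) ->
  wprim p.+2 f1 r = r ^+ p.+1 * f r - p.+1%:R * wprim p f r.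
Proof.
move=> cf1 f'; have cf x := is_derive1_continuous (f' x).
suff <- : (fun r => r ^+ p.+1 * f r - p.+1%:R * wprim p f r) = wprim p.+2 f1 by [].
apply: prim_unique; first exact: continuous_mulXn.
  move=> x; have := @is_deriveB R _ _ _ _ x 1 _ _
    (is_deriveM (is_derive_Xn p.+1 x) (f' x))
    (is_deriveM (@is_derive_cst R R R p.+1%:R x 1) (is_derive_wprim p x cf)).
  by move=> /is_derive_eq; apply; rewrite /GRing.scale/= !exprS; ring.
by rewrite wprim0 expr0n mul0r mulr0 subr0.
Qed.

(** Differentiation under the integral sign, in the form
    [(int_0^1 t^p f (t r) dt)' = r int_0^1 t^(p+2) f1 (t r) dt] for
    [f' = r f1]. Averages thus preserve [smooth] at the cost of raising the
    weight. *)
Lemma is_derive_avg (p : nat) f f1 : continuous f1 ->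
  (forall r : R, is_derive r 1 f (r * f1 r)) ->
  forall r : R, is_derive r 1 (avg p f) (r * avg p.+2 f1 r).
Proof.
move=> cf1 f'; have cf x := is_derive1_continuous (f' x).
apply: is_derive_removable => [| |r r0]; first exact: continuous_avg.
  by move=> x; apply: cvgM; [exact: cvg_id|exact: continuous_avg].
apply: (@near_eq_is_derive _ _ _ (fun x : R => wprim p f x * (x ^+ p.+1)^-1)).
  near=> t; rewrite /avg ifF//; apply/negbTE; near: t.
  by exists `|r|; rewrite /= ?normr_gt0// => t /=;
    case: eqVneq => // ->; rewrite subr0 ltxx.
have rp : r ^+ p.+1 != 0 by rewrite expf_neq0.
have := is_deriveM (is_derive_wprim p r cf)
  (is_deriveV (f := fun t : R => t ^+ p.+1) rp (is_derive_Xn p.+1 r)).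
move=> /is_derive_eq; apply; rewrite /GRing.scale/= /avg (negbTE r0).
rewrite (wprim_by_parts _ _ cf1 f').
rewrite !exprS; field.
by rewrite r0 expf_neq0.
Unshelve. all: by end_near. Qed.

(** Regularity of order [k] in the variable [r^2], as [f' = r f1] means that
    [f1] is twice the derivative of [f] with respect to [r^2]. This is the
    condition under which [x |-> f |x|] is regular at the origin; mere
    regularity in [r] would let through [f r = r]. *)
Fixpoint smooth (k : nat) f : Prop :=
  if k is k'.+1 then
    exists2 f1, (forall r : R, is_derive r 1 f (r * f1 r)) & smooth k' f1
  else continuous f.

Lemma smooth_continuous k f : smooth k f -> continuous f.
Proof.
by case: k => [//|k] [f1 f' _] x; apply: is_derive1_continuous (f' x).
Qed.

Lemma smoothW k f : smooth k.+1 f -> smooth k f.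
Proof.
elim: k f => [|k IH] f; first exact: smooth_continuous.
by move=> [f1 f' /IH sf1]; exists f1.
Qed.

Lemma smooth_le j k f : (j <= k)%N -> smooth k f -> smooth j f.
Proof.
move=> /subnKC <-; elim: (k - j)%N => [|i IH]; first by rewrite addn0.
by rewrite addnS => /smoothW.
Qed.

Lemma smooth_cst k (a : R) : smooth k (cst a).
Proof.
elim: k a => [|k IH] a; first by move=> x; exact: cvg_cst.
by exists (cst 0) => [r|//]; rewrite mulr0; exact: is_derive_cst.
Qed.

Lemma smoothD k f g : smooth k f -> smooth k g -> smooth k (fun r => f r + g r).
Proof.
elim: k f g => [|k IH] f g; first by move=> cf cg x; apply: cvgD; [exact: cf|exact: cg].
move=> [f1 f' sf1] [g1 g' sg1]; exists (fun r => f1 r + g1 r); last exact: IH.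
by move=> r; rewrite mulrDr; apply: is_deriveD.
Qed.

Lemma smoothM k f g : smooth k f -> smooth k g -> smooth k (fun r => f r * g r).
Proof.
elim: k f g => [|k IH] f g; first by move=> cf cg x; apply: cvgM; [exact: cf|exact: cg].
move=> sf sg; have [f1 f' sf1] := sf; have [g1 g' sg1] := sg.
exists (fun r => f1 r * g r + f r * g1 r).
  move=> r; have := is_deriveM (f' r) (g' r).
  by move=> /is_derive_eq; apply; rewrite /GRing.scale/=; ring.
by apply: smoothD; apply: IH => //; exact: smoothW.
Qed.

Lemma smoothN k f : smooth k f -> smooth k (fun r => - f r).
Proof.
move=> sf; rewrite (_ : (fun _ => _) = fun r => cst (-1) r * f r).
  by apply: smoothM => //; exact: smooth_cst.
by apply/funext => r; rewrite mulN1r.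
Qed.

Lemma smooth_expR k f : smooth k f -> smooth k (fun r => expR (f r)).
Proof.
elim: k f => [|k IH] f sf.
  by move=> x; apply: continuous_comp; [exact: sf|exact: continuous_expR].
have [f1 f' sf1] := sf; exists (fun r => expR (f r) * f1 r).
  move=> r; have := is_derive1_comp (is_derive_expR (f r)) (f' r).
  by move=> /is_derive_eq; apply; rewrite mulrCA.
by apply: smoothM => //; apply: IH; exact: smoothW.
Qed.

Lemma continuous_comp_abs f : continuous f -> continuous (fun r : R => f `|r|).
Proof.
move=> cf x; apply: (@continuous_comp _ _ _ (fun r : R => `|r|) f).
  exact: norm_continuous.
exact: cf.
Qed.

Lemma is_derive_comp_abs f f1 : continuous f1 ->
  (forall r : R, is_derive r 1 f (r * f1 r)) ->
  forall r : R, is_derive r 1 (fun r : R => f `|r|) (r * f1 `|r|).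
Proof.
move=> cf1 f'; have cf x := is_derive1_continuous (f' x).
apply: is_derive_removable; first exact: continuous_comp_abs.
  by move=> x; apply: cvgM; [exact: cvg_id|exact: continuous_comp_abs].
move=> x; case: ltgtP => // x0 _.
  apply: (@near_eq_is_derive _ _ _ (f \o -%R)).
    by near=> t; rewrite /= ltr0_norm//; near: t; exact: lt_nbhsl.
  have := is_derive1_comp (f' (- x)) (is_deriveNid x 1).
  by move=> /is_derive_eq; apply; rewrite ltr0_norm//; ring.
apply: (@near_eq_is_derive _ _ _ f).
  by near=> t; rewrite /= gtr0_norm//; near: t; exact: lt_nbhsr.
by rewrite gtr0_norm.
Unshelve. all: by end_near. Qed.

(** Only the values of a profile on [0, +oo[ matter: a profile may be replaced
    by its even reflection without loss of regularity. *)
Lemma smooth_abs k f : smooth k f -> smooth k (fun r => f `|r|).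
Proof.
elim: k f => [|k IH] f; first exact: continuous_comp_abs.
move=> [f1 f' sf1]; exists (fun r => f1 `|r|); last exact: IH.
by apply: is_derive_comp_abs => //; exact: smooth_continuous sf1.
Qed.

Lemma smooth_avg k p f : smooth k f -> smooth k (avg p f).
Proof.
elim: k p f => [|k IH] p f; first exact: continuous_avg.
move=> [f1 f' sf1]; exists (avg p.+2 f1); last exact: IH.
by move=> r; apply: is_derive_avg => //; exact: smooth_continuous sf1.
Qed.

(** The solution [w] of [Delta w = f] with [w 0 = 0]: by definition of [avg],
    [w' = r avg (n-1) f] is [r^(1-n) int_0^r t^(n-1) f t dt]. *)
Definition invlap (n : nat) f : R -> R := prim (fun r => r * avg n.-1 f r).

Lemma is_derive_invlap n f (r : R) : continuous f ->
  is_derive r 1 (invlap n f) (r * avg n.-1 f r).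
Proof.
move=> cf; apply: (is_derive_prim (f := fun r => _)) => x.
by apply: cvgM; [exact: cvg_id|exact: continuous_avg].
Qed.

(** A single order is gained here although [invlap] inverts a second order
    operator, since one order of [smooth] counts for two derivatives in [r]. *)
Lemma smooth_invlap k n f : smooth k f -> smooth k.+1 (invlap n f).
Proof.
move=> sf; exists (avg n.-1 f); last exact: smooth_avg.
by move=> r; apply/is_derive_invlap/smooth_continuous/sf.
Qed.

End EvenCalculus.

(** * Comparison for the radial Laplacian *)

Section Comparison.
Context {R : realType} (n : nat).
Hypothesis n_gt0 : (0 < n)%N.
Implicit Types f g w : R -> R.

(** The radial equation [w'' + (n-1)/r w' = f] in divergence form, with
    [w1 = w'] and the condition [w'(0) = 0]. The divergence form is
    what integrates directly, and it makes no reference to [w' / r], which is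
    singular at the origin. *)
Definition radial_lap w f : Prop := exists w1 : R -> R,
  [/\ continuous w, continuous w1, w1 0 = 0,
      forall r : R, 0 < r -> is_derive r 1 w (w1 r) &
      forall r : R, 0 < r ->
        is_derive r 1 (fun t : R => t ^+ n.-1 * w1 t) (r ^+ n.-1 * f r)].

Lemma radial_lap_invlap f (a : R) : continuous f ->
  radial_lap (fun r : R => a + invlap n f r) f.
Proof.
move=> cf; exists (fun r => r * avg n.-1 f r).
have w' (r : R) : is_derive r 1 (fun r : R => a + invlap n f r) (r * avg n.-1 f r).
  have := is_deriveD (is_derive_cst a r (1 : R)) (is_derive_invlap n r cf).
  by move=> /is_derive_eq; apply; rewrite add0r.
split => //.
- by move=> r; apply: is_derive1_continuous (w' r).
- by move=> r; apply: cvgM; [exact: cvg_id|exact: continuous_avg].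
- by rewrite mul0r.
- move=> r _; apply: is_derive_ext (is_derive_wprim n.-1 r cf) => t.
  by rewrite -avgE exprSr mulrA.
Qed.

Lemma radial_lapB w f w' f' : radial_lap w f -> radial_lap w' f' ->
  radial_lap (fun r => w r - w' r) (fun r => f r - f' r).
Proof.
move=> [w1 [cw cw1 w10 dw dw1]] [w1' [cw' cw1' w10' dw' dw1']].
exists (fun r => w1 r - w1' r); split.
- by move=> x; apply: cvgB; [exact: cw|exact: cw'].
- by move=> x; apply: cvgB; [exact: cw1|exact: cw1'].
- by rewrite w10 w10' subr0.
- by move=> r r0; apply: is_deriveB; [exact: dw|exact: dw'].
- move=> r r0; rewrite mulrBr.
  refine (is_derive_ext _ (is_deriveB (dw1 r r0) (dw1' r r0))) => t.
  by rewrite !fctE mulrBr.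
Qed.

(** Two integrations of an upper bound: [r^(n-1) w' <= c r^(n+k)], then
    [w' <= c r^(k+1)] and [w <= c r^(k+2) / (k+2)]. For [c = 0] this is the
    monotonicity of the inverse Laplacian. *)
Lemma radial_lap_le w f (c rho : R) (k : nat) : radial_lap w f -> w 0 = 0 ->
  0 <= c -> (forall r : R, 0 < r < rho -> f r <= c * r ^+ k) ->
  forall r : R, 0 <= r <= rho -> w r <= c / k.+2%:R * r ^+ k.+2.
Proof.
move=> [w1 [cw cw1 w10 dw dw1]] w0 c0 fc r /andP[r0 rrho].
have w1_le x : 0 <= x <= rho -> x ^+ n.-1 * w1 x <= c * x ^+ (n + k).
  move=> /andP[x0 xrho].
  apply: (@le_of_derive_le R (fun t => t ^+ n.-1 * w1 t) (fun t => c * t ^+ (n + k))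
    (fun t => t ^+ n.-1 * f t) (fun t => c * ((n + k)%:R * t ^+ (n + k).-1)) 0 x) => //.
  - by apply: continuous_subspaceT; exact: continuous_mulXn.
  - by apply: continuous_subspaceT; exact: continuous_cXn.
  - by move=> t /andP[t0 _]; exact: dw1.
  - by move=> t _; exact: is_derive_cXn.
  - move=> t /andP[t0 tx].
    have -> : (n + k).-1 = (n.-1 + k)%N by case: (n) n_gt0.
    have -> : c * ((n + k)%:R * t ^+ (n.-1 + k)) =
        t ^+ n.-1 * ((n + k)%:R * (c * t ^+ k)) by rewrite exprD; ring.
    rewrite ler_wpM2l ?exprn_ge0 ?(ltW t0)//.
    apply: (@le_trans _ _ (c * t ^+ k)).
      by apply: fc; rewrite t0 (lt_le_trans tx).
    rewrite ler_peMl ?mulr_ge0 ?exprn_ge0 ?(ltW t0)// ler1n.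
    by rewrite addn_gt0 n_gt0.
  - by rewrite w10 mulr0 expr0n addn_eq0 (gtn_eqF n_gt0) mulr0.
have w1le x : 0 < x -> x <= rho -> w1 x <= c * x ^+ k.+1.
  move=> x0 xrho; have := w1_le x; rewrite ltW// xrho => /(_ isT).
  have -> : (n + k = n.-1 + k.+1)%N by case: (n) n_gt0 => // j; rewrite addSnnS.
  by rewrite exprD mulrCA ler_pM2l// exprn_gt0.
apply: (@le_of_derive_le R w (fun t => c / k.+2%:R * t ^+ k.+2) w1
    (fun t => c / k.+2%:R * (k.+2%:R * t ^+ k.+1)) 0 r) => //.
- exact: continuous_subspaceT.
- by apply: continuous_subspaceT; exact: continuous_cXn.
- by move=> t /andP[t0 _]; exact: dw.
- by move=> t _; exact: is_derive_cXn.
- move=> t /andP[t0 tr]; rewrite mulrA divfK ?pnatr_eq0//.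
  by apply: w1le => //; rewrite (le_trans _ rrho)// ltW.
- by rewrite w0 expr0n mulr0.
Qed.

Lemma radial_lap0 : radial_lap (cst 0) (cst 0).
Proof.
exists (cst 0); split => //; try by move=> x; exact: cvg_cst.
  by move=> r _; exact: is_derive_cst.
move=> r _; rewrite [cst 0 r]/(0 : R) mulr0.
by apply: is_derive_ext (@is_derive_cst R R R 0 r 1) => t; rewrite /= mulr0.
Qed.

Lemma radial_lap_norm_le w f (c rho : R) (k : nat) :
  radial_lap w f -> w 0 = 0 -> 0 <= c ->
  (forall r : R, 0 < r < rho -> `|f r| <= c * r ^+ k) ->
  forall r : R, 0 <= r <= rho -> `|w r| <= c / k.+2%:R * r ^+ k.+2.
Proof.
move=> wf w0 c0 fc r hr; rewrite ler_norml lerNl; apply/andP; split.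
  have := radial_lapB radial_lap0 wf => /radial_lap_le wle.
  rewrite -[leLHS]sub0r; apply: (wle _ rho) => //; first by rewrite w0 subr0.
  by move=> x /fc; rewrite ler_norml => /andP[+ _]; rewrite lerNl sub0r.
apply: (radial_lap_le wf w0 c0 _ hr) => x /fc.
by apply: le_trans; exact: ler_norm.
Qed.

(** Along a chain [Delta d_i = d_(i+1)] the first inversion yields the gain
    [r^2 / (k+2)]; each of the [m] others is only used through the crude factor
    [rho^2], which keeps the bound a monomial of degree [k+2]. *)
Lemma chain_norm_le (m : nat) (d : nat -> R -> R) (c rho : R) (k : nat) :
  (forall i, (i <= m)%N -> radial_lap (d i) (d i.+1)) ->
  (forall i, (i <= m)%N -> d i 0 = 0) -> 0 <= c ->
  (forall r : R, 0 < r < rho -> `|d m.+1 r| <= c * r ^+ k) ->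
  forall r : R, 0 <= r <= rho ->
    `|d 0%N r| <= c * rho ^+ (2 * m) / k.+2%:R * r ^+ k.+2.
Proof.
elim: m d => [|m IH] d dd d0 c0 dm r hr.
  rewrite expr0 mulr1; apply: (radial_lap_norm_le _ _ c0 dm) => //.
    exact: dd.
  exact: d0.
have rho0 : 0 <= rho by case/andP: hr; exact: le_trans.
set c' := c * rho ^+ (2 * m) / k.+2%:R.
have c'0 : 0 <= c' by rewrite divr_ge0// mulr_ge0// exprn_ge0.
have IHd x : 0 < x < rho -> `|d 1%N x| <= c' * x ^+ k.+2.
  move=> /andP[x0 xr]; apply: (IH (fun i => d i.+1)) => //.
  - by move=> i im; exact: dd.
  - by move=> i im; exact: d0.
  - by rewrite !ltW.
apply: (le_trans (radial_lap_norm_le (dd 0%N isT) (d0 0%N isT) c'0 IHd hr)).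
case/andP: hr => r0 rrho.
have -> : c * rho ^+ (2 * m.+1) / k.+2%:R * r ^+ k.+2 = c' * rho ^+ 2 * r ^+ k.+2.
  by rewrite /c' mulnS exprD; ring.
have -> : c' / k.+4%:R * r ^+ k.+4 = c' * (r ^+ 2 / k.+4%:R) * r ^+ k.+2.
  by rewrite -addn2 exprD; ring.
rewrite ler_wpM2r ?exprn_ge0// ler_wpM2l//.
apply: (@le_trans _ _ (r ^+ 2)); last by rewrite lerXn2r.
by rewrite ler_piMr ?exprn_ge0// invf_le1 ?ltr0n// ler1n.
Qed.

(** The radial solution of [Delta^m w = g], where [m] is the length of [s] and the
    [k]-th entry of [s] is the prescribed value of [Delta^k w] at the origin. *)
Definition solve (s : seq R) g : R -> R :=
  foldr (fun a w r => a + invlap n w r) g s.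

Lemma smooth_solve k s g : smooth k g -> smooth (size s + k) (solve s g).
Proof.
move=> sg; elim: s => [//|a s IH].
exact: smoothD (smooth_cst _ a) (smooth_invlap n IH).
Qed.

Lemma continuous_solve s g : continuous g -> continuous (solve s g).
Proof.
by move=> cg; apply: (@smooth_continuous _ (size s + 0)); exact: smooth_solve.
Qed.

Lemma solve0 a s g : solve (a :: s) g 0 = a.
Proof. by rewrite /= /invlap prim0 addr0. Qed.

Lemma radial_lap_solve s g i : continuous g -> (i < size s)%N ->
  radial_lap (solve (drop i s) g) (solve (drop i.+1 s) g).
Proof.
move=> cg /(drop_nth 0) -> /=.
exact/radial_lap_invlap/continuous_solve.
Qed.

Lemma solve_le s g g' : continuous g -> continuous g' ->
  (forall r : R, 0 <= r -> g r <= g' r) ->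
  forall r : R, 0 <= r -> solve s g r <= solve s g' r.
Proof.
move=> cg cg' gg'; elim: s => [//|a s IH] r r0.
have := radial_lapB (radial_lap_invlap a (continuous_solve (s := s) cg))
  (radial_lap_invlap a (continuous_solve (s := s) cg')).
move=> /(@radial_lap_le _ _ 0 r 0%N)-/(_ _ _ _ r).
rewrite !mul0r subr_le0; apply => //; last by rewrite r0 lexx.
  by rewrite /invlap !prim0 subrr.
by move=> x /andP[x0 _]; rewrite mul0r subr_le0 IH// ltW.
Qed.

Lemma solve_dist s g g' (c rho : R) k : continuous g -> continuous g' ->
  (0 < size s)%N -> 0 <= c ->
  (forall r : R, 0 < r < rho -> `|g r - g' r| <= c * r ^+ k) ->
  forall r : R, 0 <= r <= rho -> `|solve s g r - solve s g' r|
     <= c * rho ^+ (2 * (size s).-1) / k.+2%:R * r ^+ k.+2.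
Proof.
move=> cg cg' s0 c0 gg' r hr.
pose d i r := solve (drop i s) g r - solve (drop i s) g' r.
have -> : solve s g r - solve s g' r = d 0%N r by rewrite /d drop0.
apply: chain_norm_le => // [i|i|].
- move=> ism; have {}ism : (i < size s)%N by rewrite -(prednK s0).
  by apply: radial_lapB; exact: radial_lap_solve.
- move=> ism; have {}ism : (i < size s)%N by rewrite -(prednK s0).
  by rewrite /d (drop_nth 0)// !solve0 subrr.
- by rewrite (prednK s0) /d drop_size.
Qed.

End Comparison.

(** * Picard iteration and its uniform limit *)

Section Picard.
Context {R : realType}.

(** Weierstrass' criterion for the series of the differences of a sequence
    of continuous functions, on every ball. Two consecutive indices are bounded
    together, as this is what the passage to the limit in a recursion
    [u_(k+1) = Phi u_k] uses. *)
Lemma telescoping_uniform_limit (u : nat -> R -> R) :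
  (forall k, continuous (u k)) ->
  (forall rho : R, exists b : R^nat,
    [/\ forall k, 0 <= b k, cvgn (series b) &
        forall k (r : R), `|r| <= rho -> `|u k.+1 r - u k r| <= b k]) ->
  exists2 v : R -> R, continuous v &
    forall rho e : R, 0 < e -> exists k, forall r : R, `|r| <= rho ->
      `|v r - u k r| <= e /\ `|v r - u k.+1 r| <= e.
Proof.
move=> cu bu; pose v r := limn (u ^~ r).
have uv (rho e : R) : 0 < e -> exists k0, forall k, (k0 <= k)%N ->
    forall r : R, `|r| <= rho -> `|v r - u k r| <= e.
  move=> e0; have [b [b0 cS hb]] := bu rho; pose S := series b.
  have ndS : nondecreasing_seq S.
    by apply/nondecreasing_seqP => k; rewrite /S seriesSr lerDl.
  have dist_u k l (r : R) : (k <= l)%N -> `|r| <= rho -> `|u l r - u k r| <= S l - S k.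
    move=> kl hr; rewrite -(subnKC kl); elim: (l - k)%N => [|j IH].
      by rewrite addn0 !subrr normr0.
    rewrite addnS {1}/S seriesSr -/S.
    rewrite (_ : u _ r - u k r =
      (u (k + j).+1 r - u (k + j)%N r) + (u (k + j)%N r - u k r)); last by ring.
    rewrite (le_trans (ler_normD _ _))// addrAC [leRHS]addrC lerD//.
    exact: hb.
  have cu_r (r : R) : `|r| <= rho -> u k r @[k --> \oo] --> v r.
    move=> hr; suff : cvgn (u ^~ r) by [].
    have : cvgn (series (telescope (u ^~ r))).
      apply: normed_cvg; apply: series_le_cvg cS => // k.
        exact: normr_ge0.
      exact: (hb k r hr).
    rewrite telescopeK => /(is_cvgD (is_cvg_cst (u 0%N r))).
    rewrite (_ : _ + _ = u ^~ r)//; apply/funext => k.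
    by rewrite !fctE/= addrC subrK.
  (* The tail of the series dominates the distance to the limit, uniformly in
     [r]. *)
  have /cvgrPdist_le/(_ e e0)[k0 _ hk0] := cS.
  exists k0 => k k0k r hr; apply: (@le_trans _ _ (limn S - S k)); last first.
    by apply: le_trans (hk0 k k0k); rewrite ler_norm.
  apply: (@cvgr_to_le _ \oo _ _ (fun l => `|u l r - u k r|)).
    by apply: cvg_norm; apply: cvgB; [exact: cu_r|exact: cvg_cst].
  exists k => // l /= kl; apply: (le_trans (dist_u _ _ _ kl hr)).
  by rewrite lerD2r nondecreasing_cvgn_le.
exists v => [r|rho e e0]; last first.
  have [k hk] := uv rho e e0; exists k => r hr.
  by split; apply: hk.
apply/cvgrPdist_lt => e e0.
have e3 : 0 < e / 4 by rewrite divr_gt0.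
have [k hk] := uv (`|r| + 1) (e / 4) e3.
have /cvgrPdist_lt/(_ _ e3) := cu k r.
apply: filter_app; near=> t => ut.
have hr : `|v r - u k r| <= e / 4 by apply: hk => //; rewrite lerDl.
have ht : `|v t - u k t| <= e / 4.
  apply: hk => //; rewrite -[t](subrK r) (le_trans (ler_normD _ _))// addrC lerD2l.
  by rewrite distrC; near: t; exists 1 => //= t; exact: ltW.
rewrite (_ : v r - v t = (v r - u k r) + (u k r - u k t) - (v t - u k t)); last by ring.
apply: (le_lt_trans (ler_normB _ _)).
apply: (@le_lt_trans _ _ (e / 4 + e / 4 + e / 4)); last by lra.
by rewrite lerD// (le_trans (ler_normD _ _))// lerD// ltW.
Unshelve. all: by end_near. Qed.

Variables (n : nat) (s : seq R).
Hypotheses (n_gt0 : (0 < n)%N) (s_gt0 : (0 < size s)%N).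

(** The absolute value makes every iterate even, so that estimates on
    [0, rho] extend to negative arguments. *)
Definition picard (u : R -> R) : R -> R :=
  fun r => solve n s (fun t => - expR (u t)) `|r|.

Definition picard_iter (k : nat) : R -> R :=
  iter k picard (fun r => solve n s (cst 0) `|r|).

Lemma continuous_Nexp (u : R -> R) : continuous u ->
  continuous (fun r : R => - expR (u r)).
Proof. by move=> cu; exact: (@smoothN R 0 _ (@smooth_expR R 0 _ cu)). Qed.

Lemma continuous_picard u : continuous u -> continuous (picard u).
Proof.
by move=> cu; apply/continuous_comp_abs/continuous_solve/continuous_Nexp.
Qed.

(** The right-hand side [- e^u] is negative, and [solve] is monotone in it. This
    a priori bound is the reason why solutions cannot blow up. *)
Lemma picard_le u r : continuous u -> picard u r <= solve n s (cst 0) `|r|.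
Proof.
move=> cu; apply: solve_le => //; first exact: continuous_Nexp.
  by move=> x; exact: cvg_cst.
by move=> t _; rewrite lerNl oppr0 expR_ge0.
Qed.

Lemma continuous_picard_iter k : continuous (picard_iter k).
Proof.
elim: k => [|k IH]; last exact: continuous_picard.
by apply/continuous_comp_abs/continuous_solve => x; exact: cvg_cst.
Qed.

Lemma picard_iter_le k r : picard_iter k r <= solve n s (cst 0) `|r|.
Proof. by case: k => [//|k]; apply/picard_le/continuous_picard_iter. Qed.

Lemma picard_abs u r : picard u `|r| = picard u r.
Proof. by rewrite /picard normr_id. Qed.

Lemma picard_iter_abs k r : picard_iter k `|r| = picard_iter k r.
Proof. by case: k => [|k]; rewrite /picard_iter/= ?picard_abs ?normr_id. Qed.

(** Below the common upper bound [C] the exponential is Lipschitz with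
    constant [e^C], so [solve_dist] applies to the two right-hand sides. *)
Lemma picard_dist (rho C c : R) (k : nat) (u v : R -> R) :
  continuous u -> continuous v -> 0 <= c ->
  (forall r : R, 0 <= r <= rho -> u r <= C) ->
  (forall r : R, 0 <= r <= rho -> v r <= C) ->
  (forall r : R, 0 <= r <= rho -> `|u r - v r| <= c * r ^+ k) ->
  forall r : R, 0 <= r <= rho -> `|picard u r - picard v r| <=
    c * (expR C * rho ^+ (2 * (size s).-1)) / k.+2%:R * r ^+ k.+2.
Proof.
move=> cu cv c0 uC vC uv r hr; have [r0 _] := andP hr.
rewrite /picard (ger0_norm r0).
rewrite mulrA; apply: (solve_dist n_gt0 _ _ s_gt0) hr.
- exact: continuous_Nexp.
- exact: continuous_Nexp.
- by rewrite mulr_ge0// expR_ge0.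
move=> t /andP[t0 tr]; have ht : 0 <= t <= rho by rewrite !ltW.
rewrite -opprD normrN; apply: le_trans (expR_lipschitz _ _) _.
- exact: uC.
- exact: vC.
- by rewrite mulrAC [leRHS]mulrC ler_wpM2l ?expR_ge0// uv.
Qed.

End Picard.

(** * Global solution of the integral equation *)

Section FixedPoint.
Context {R : realType} (n : nat) (s : seq R).
Hypotheses (n_gt0 : (0 < n)%N) (s_gt0 : (0 < size s)%N).

(** Iterating [picard_dist] from a bound of degree [0] gives the summable
    bounds [M (K rho^2)^k / k!]. *)
Lemma picard_iter_dist (rho : R) : exists2 b : R^nat,
  (forall k, 0 <= b k) /\ cvgn (series b) &
  forall k (r : R), `|r| <= rho ->
    `|picard_iter n s k.+1 r - picard_iter n s k r| <= b k.
Proof.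
pose u := picard_iter n s.
have cu k : continuous (u k) by exact: continuous_picard_iter.
have [C _ hC] : exists2 C, 0 <= C &
    forall r : R, 0 <= r <= rho -> `|solve n s (cst 0) r| <= C.
  by apply/continuous_bounded/continuous_solve => x; exact: cvg_cst.
have uC k (r : R) : 0 <= r <= rho -> u k r <= C.
  move=> hr; apply: (le_trans (picard_iter_le s n_gt0 k r)).
  have [r0 _] := andP hr; rewrite ger0_norm//.
  by apply: (le_trans (ler_norm _)); exact: hC.
have [M M0 hM] : exists2 M, 0 <= M &
    forall r : R, 0 <= r <= rho -> `|u 1%N r - u 0%N r| <= M.
  by apply: continuous_bounded => x; apply: cvgB; exact: cu.
pose K := expR C * rho ^+ (2 * (size s).-1).
have K0 : 0 <= K by rewrite mulr_ge0 ?expR_ge0// exprM exprn_ge0// sqr_ge0.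
have udist k (r : R) : 0 <= r <= rho ->
    `|u k.+1 r - u k r| <= M * exp_coeff K k * r ^+ (2 * k).
  elim: k r => [|k IH] r hr.
    by rewrite muln0 expr0 mulr1 /exp_coeff /= expr0 fact0 divr1 mulr1 hM.
  have [r0 _] := andP hr.
  apply: (le_trans (picard_dist n_gt0 s_gt0 (cu k.+1) (cu k) _ (uC k.+1) (uC k) IH hr)).
    by rewrite mulr_ge0// exp_coeff_ge0.
  rewrite -/K mulnS !addSn add0n ler_wpM2r ?exprn_ge0//.
  by apply: le_trans (ler_wpM2l M0 (exp_coeff_step k K0)); rewrite !mulrA.
exists (M *: exp_coeff (K * rho ^+ 2)) => [|k r hr].
  split; last by apply: is_cvg_seriesZ; exact: is_cvg_series_exp_coeff.
  by move=> k; rewrite mulr_ge0// exp_coeff_ge0// mulr_ge0// sqr_ge0.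
rewrite -picard_iter_abs -[X in _ - X]picard_iter_abs.
have hr' : 0 <= `|r| <= rho by rewrite normr_ge0.
apply: (le_trans (udist k _ hr')); rewrite fctE /GRing.scale/= -mulrA ler_wpM2l//.
rewrite exp_coeffMl -exprM ler_wpM2l ?exp_coeff_ge0// lerXn2r//.
by rewrite nnegrE (le_trans (normr_ge0 r)).
Qed.

(** The limit [u] inherits the bound [u <= P] of the iterates, hence
    [picard_dist] also compares [u] with an iterate, and
    [u - picard u = (u - u_(k+1)) - (picard u - picard u_k)] is arbitrarily
    small. *)
Lemma picard_fixpoint : exists2 u : R -> R, continuous u & u = picard n s u.
Proof.
have [||u cu hu] := @telescoping_uniform_limit R (picard_iter n s).
- exact: continuous_picard_iter.
- by move=> rho; have [b [b0 cb] hb] := picard_iter_dist rho; exists b.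
exists u => //; apply/funext => r; apply/eqP; rewrite -subr_eq0 -normr_le0.
have uP (t : R) : u t <= solve n s (cst 0) `|t|.
  apply/ler_addgt0Pr => e e0; have [k hk] := hu `|t| e e0.
  have := (hk t (lexx _)).1; rewrite ler_norml => /andP[_].
  by have := picard_iter_le s n_gt0 k t; lra.
set rho := `|r|; have rho0 : 0 <= rho by exact: normr_ge0.
have [C _ hC] : exists2 C, 0 <= C &
    forall r : R, 0 <= r <= rho -> `|solve n s (cst 0) r| <= C.
  by apply/continuous_bounded/continuous_solve => x; exact: cvg_cst.
have PC (t : R) : 0 <= t <= rho -> solve n s (cst 0) `|t| <= C.
  move=> ht; have [t0 _] := andP ht; rewrite ger0_norm//.
  by apply: (le_trans (ler_norm _)); exact: hC.
(* The Lipschitz constant of [picard] on [0, rho], from [picard_dist] with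
   [k = 0]. *)
pose L := expR C * rho ^+ (2 * (size s).-1) / 2%:R * rho ^+ 2.
have L0 : 0 <= L by rewrite !mulr_ge0 ?expR_ge0 ?exprn_ge0 ?invr_ge0.
apply/ler_addgt0Pr => e e0; rewrite add0r.
have e' : 0 < e / (1 + L) by rewrite divr_gt0// ltr_wpDr.
have [k hk] := hu rho _ e'.
have hr : 0 <= rho <= rho by rewrite lexx normr_ge0.
have : `|picard n s u rho - picard n s (picard_iter n s k) rho| <=
    e / (1 + L) * L.
  apply: le_trans (picard_dist n_gt0 s_gt0 (k := 0%N) (C := C) (c := e / (1 + L))
    cu (@continuous_picard_iter R n s k) _ _ _ _ hr) _.
  - exact: ltW.
  - by move=> t ht; apply: le_trans (PC t ht).
  - by move=> t ht; apply: le_trans (PC t ht); exact: picard_iter_le.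
  - move=> t /andP[t0 tr]; rewrite expr0 mulr1; apply: (hk _ _).1.
    by rewrite ger0_norm.
  - by rewrite /L !mulrA.
have [_ h1] := hk r (lexx _).
rewrite !picard_abs => h2.
rewrite (_ : u r - _ = (u r - picard_iter n s k.+1 r)
   - (picard n s u r - picard n s (picard_iter n s k) r)); last first.
  by rewrite /picard_iter iterS; ring.
rewrite (le_trans (ler_normB _ _))// (le_trans (lerD h1 h2))//.
by rewrite -{1}[e / (1 + L)]mulr1 -mulrDr divfK// gt_eqF// ltr_wpDr.
Qed.

(** Bootstrap: the right-hand side is as smooth as [u], and [solve] gains at
    least one order. *)
Lemma smooth_picard_fixpoint u k : continuous u -> u = picard n s u -> smooth k u.
Proof.
move=> cu uE; elim: k => [//|k IH]; rewrite uE; apply: smooth_abs.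
have := smooth_solve n s (smoothN (smooth_expR IH)).
by apply: smooth_le; rewrite -add1n leq_add2r.
Qed.
End FixedPoint.

(** * Differentiability of radial functions on R^n *)

Section VectorCalculus.
Context {R : realType} {n : nat}.
Implicit Types (F G : 'rV[R]_n -> R) (x : 'rV[R]_n) (i : 'I_n).

(** A directional derivative is an ordinary derivative along a line, on which
    the norm has the explicit form of [enorm_line]. *)
Lemma is_derive_lineP (V : normedModType R) (F : V -> R) (x v : V) (l : R) :
  is_derive (0 : R) 1 (fun h : R => F (h *: v + x)) l <-> is_derive x v F l.
Proof.
have E : (fun h : R => h^-1 *: (((fun h => F (h *: v + x)) \o shift 0) (h *: (1 : R))
      - F (0 *: v + x)))
    = (fun h : R => h^-1 *: ((F \o shift x) (h *: v) - F x)).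
  by apply/funext => h /=; rewrite addr0 scale0r add0r [_%:A]mulr1.
by split=> -[dF <-]; split; rewrite /derive ?E//; move: dF; rewrite /derivable E.
Qed.

Lemma enorm_ge0 x : 0 <= enorm x. Proof. exact: sqrtr_ge0. Qed.

Lemma sqr_enorm x : enorm x ^+ 2 = \sum_(i < n) x ord0 i ^+ 2.
Proof. by rewrite sqr_sqrtr// sumr_ge0// => i _; exact: sqr_ge0. Qed.

Lemma enorm_eq0_coord x i : enorm x = 0 -> x ord0 i = 0.
Proof.
move=> /(congr1 (fun r => r ^+ 2)); rewrite sqr_enorm expr0n /= => /eqP.
rewrite psumr_eq0 => [/allP/(_ i)|j _]; last exact: sqr_ge0.
by rewrite mem_index_enum sqrf_eq0 => /(_ isT)/eqP.
Qed.

Lemma enorm_line x i (h : R) :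
  enorm (h *: 'e_i + x) = Num.sqrt (enorm x ^+ 2 + 2 * x ord0 i * h + h ^+ 2).
Proof.
rewrite /enorm; congr Num.sqrt; rewrite -/(enorm x) sqr_enorm.
rewrite !(bigD1 i (P := xpredT))//= !mxE !eqxx mulr1.
rewrite (eq_bigr (fun j => x ord0 j ^+ 2)); first by ring.
by move=> j ji; rewrite !mxE (negbTE ji) andbF mulr0 add0r.
Qed.

Lemma continuous_coord i : continuous (fun x : 'rV[R]_n => x ord0 i).
Proof. exact: coord_continuous. Qed.

Lemma radial_comp_abs (f : R -> R) :
  radial (fun r => f `|r|) = radial f :> ('rV[R]_n -> R).
Proof. by apply/funext => x; rewrite /radial ger0_norm// enorm_ge0. Qed.

Lemma is_derive_radial (f : R -> R) x i (l : R) : enorm x != 0 ->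
  is_derive (enorm x) 1 f l ->
  is_derive x 'e_i (radial f) (l * (x ord0 i / enorm x)).
Proof.
move=> x0 df; apply/is_derive_lineP.
have px : 0 < enorm x by rewrite lt_neqAle eq_sym x0 enorm_ge0.
pose q (h : R) := enorm x ^+ 2 + 2 * x ord0 i * h + h ^+ 2.
have q0 : q 0 = enorm x ^+ 2 by rewrite /q mulr0 expr0n !addr0.
have dq : is_derive (0 : R) 1 q (2 * x ord0 i).
  have := is_deriveD (is_deriveD
    (@is_derive_cst R R R (enorm x ^+ 2) 0 1) (is_derive_cXn (2 * x ord0 i) 1 0))
    (is_derive_Xn 2 (0 : R)).
  by move=> /is_derive_eq; apply; rewrite /=; ring.
have sq0 : Num.sqrt (q 0) = enorm x by rewrite q0 sqrtr_sqr gtr0_norm.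
have dsq : is_derive (0 : R) 1 (Num.sqrt \o q) (x ord0 i / enorm x).
  have := @is_derive1_comp _ Num.sqrt q 0 _ _ (is_derive1_sqrt _) dq.
  rewrite sq0 q0 exprn_gt0// => /(_ isT)/is_derive_eq; apply.
  by field.
rewrite -sq0 in df.
have := @is_derive1_comp R f (Num.sqrt \o q) 0 _ _ df dsq.
apply: is_derive_ext => h.
by rewrite /radial enorm_line.
Qed.

Lemma Ck_intro k F : continuous F ->
  (forall i, exists2 G, (forall x, is_derive x 'e_i F (G x)) & Ck k G) ->
  Ck k.+1 F.
Proof.
move=> cF dF; split=> // i; have [G FG CG] := dF i.
split; first by move=> x; exact: (@ex_derive _ _ _ _ _ _ _ (FG x)).
suff -> : partial i F = G by [].
by apply/funext => x; exact: (@derive_val _ _ _ _ _ _ _ (FG x)).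
Qed.

Lemma is_derive_partial i F (G : 'rV[R]_n -> R) :
  (forall x, is_derive x 'e_i F (G x)) -> partial i F = G.
Proof. by move=> FG; apply/funext => x; exact: (@derive_val _ _ _ _ _ _ _ (FG x)). Qed.

Lemma Ck_continuous k F : Ck k F -> continuous F.
Proof. by case: k => [//|k] []. Qed.

Lemma Ck_partial k F i : Ck k.+1 F ->
  (forall x, is_derive x 'e_i F (partial i F x)) /\ Ck k (partial i F).
Proof. by move=> [_ /(_ i)[dF CF]]; split=> // x; exact: derivableP. Qed.

Lemma CkW k F : Ck k.+1 F -> Ck k F.
Proof.
elim: k F => [|k IH] F; first exact: Ck_continuous.
move=> CF; apply: Ck_intro => [|i]; first exact: Ck_continuous CF.
by have [dF /IH CF'] := Ck_partial i CF; exists (partial i F).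
Qed.

Lemma Ck_le j k F : (j <= k)%N -> Ck k F -> Ck j F.
Proof.
move=> /subnKC <-; elim: (k - j)%N => [|i IH]; first by rewrite addn0.
by rewrite addnS => /CkW.
Qed.

Lemma Ck_cst k (a : R) : Ck k (fun _ : 'rV[R]_n => a).
Proof.
elim: k a => [|k IH] a; first exact: cst_continuous.
apply: Ck_intro => [|i]; first exact: cst_continuous.
by exists (fun=> 0) => [x|]; [exact: is_derive_cst|exact: IH].
Qed.

Lemma CkD k F G : Ck k F -> Ck k G -> Ck k (fun x => F x + G x).
Proof.
have cD F' G' : continuous F' -> continuous G' ->
    continuous (fun x : 'rV[R]_n => F' x + G' x : R).
  by move=> cF cG x; exact: (cvgD (cF x) (cG x)).
elim: k F G => [|k IH] F G CF CG; first exact: cD.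
apply: Ck_intro => [|i]; first by apply: cD; apply: Ck_continuous; eassumption.
have [dF CF'] := Ck_partial i CF; have [dG CG'] := Ck_partial i CG.
exists (fun x => partial i F x + partial i G x); last exact: IH.
by move=> x; apply: is_deriveD.
Qed.

Lemma CkM k F G : Ck k F -> Ck k G -> Ck k (fun x => F x * G x).
Proof.
have cM F' G' : continuous F' -> continuous G' ->
    continuous (fun x : 'rV[R]_n => F' x * G' x : R).
  by move=> cF cG x; exact: (cvgM (cF x) (cG x)).
elim: k F G => [|k IH] F G CF CG; first exact: cM.
apply: Ck_intro => [|i]; first by apply: cM; apply: Ck_continuous; eassumption.
have [dF CF'] := Ck_partial i CF; have [dG CG'] := Ck_partial i CG.
exists (fun x => F x * partial i G x + G x * partial i F x).
  by move=> x; exact: is_deriveM.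
by apply: CkD; apply: IH => //; exact: CkW.
Qed.

Lemma Ck_sum k (H : 'I_n -> 'rV[R]_n -> R) :
  (forall i, Ck k (H i)) -> Ck k (fun x => \sum_(i < n) H i x).
Proof.
move=> CH; elim: (index_enum _) => [|j r IH].
  rewrite (_ : (fun _ => _) = fun=> 0); first exact: Ck_cst.
  by apply/funext => x; rewrite big_nil.
rewrite (_ : (fun _ => _) = fun x => H j x + \sum_(i <- r) H i x).
  exact: CkD.
by apply/funext => x; rewrite big_cons.
Qed.

Lemma is_derive_coord x i j :
  is_derive x 'e_i (fun y : 'rV[R]_n => y ord0 j) (i == j)%:R.
Proof.
apply/is_derive_lineP.
have := is_deriveD (is_derive_cXn ((i == j)%:R : R) 1 0)
  (@is_derive_cst R R R (x ord0 j) 0 1).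
rewrite addr0 /= expr0 !mulr1; apply: is_derive_ext => h.
by rewrite !mxE !fctE expr1 eqxx /= eq_sym mulrC.
Qed.

Lemma Ck_coord k j : Ck k (fun x : 'rV[R]_n => x ord0 j).
Proof.
case: k => [|k]; first exact: continuous_coord.
apply: Ck_intro => [|i]; first exact: continuous_coord.
exists (fun=> (i == j)%:R) => [x|]; last exact: Ck_cst.
exact: is_derive_coord.
Qed.

Lemma continuous_enorm : continuous (@enorm R n).
Proof.
move=> x; apply: (@continuous_comp _ _ _
  (fun x : 'rV[R]_n => \sum_(i < n) x ord0 i ^+ 2) Num.sqrt).
  apply: (@Ck_sum 0 (fun i x => x ord0 i ^+ 2)) => i.
  exact: (CkM (Ck_coord 0 i) (Ck_coord 0 i)).
exact: sqrt_continuous.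
Qed.

Lemma continuous_radial (f : R -> R) : continuous f -> continuous (radial f : 'rV_n -> R).
Proof.
move=> cf x; apply: (@continuous_comp _ _ _ (@enorm R n) f).
  exact: continuous_enorm.
exact: cf.
Qed.

(** Off the origin this is the chain rule, the factor [|x|] of
    [f' = |x| f1] cancelling the denominator of [x_i / |x|]. At the origin the
    restriction to a coordinate line is [h |-> f |h|], with zero
    derivative. *)
Lemma is_derive_radial_smooth (f f1 : R -> R) : continuous f1 ->
  (forall r : R, is_derive r 1 f (r * f1 r)) ->
  forall x i, is_derive x 'e_i (radial f) (x ord0 i * radial f1 x).
Proof.
move=> cf1 f' x i; have [x0|x0] := eqVneq (enorm x) 0; last first.
  have := is_derive_radial i x0 (f' (enorm x)).
  by move=> /is_derive_eq; apply; rewrite /radial; field.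
apply/is_derive_lineP; rewrite (enorm_eq0_coord i x0) mul0r.
have := is_derive_comp_abs cf1 f' 0; rewrite mul0r.
apply: is_derive_ext => h.
by rewrite /radial enorm_line x0 (enorm_eq0_coord i x0) mulr0 mul0r expr0n !add0r
  sqrtr_sqr.
Qed.

Lemma Ck_radial k (f : R -> R) : smooth k f -> Ck k (radial f : 'rV[R]_n -> R).
Proof.
elim: k f => [|k IH] f sf; first exact: continuous_radial.
have [f1 f' sf1] := sf.
apply: Ck_intro => [|i]; first exact/continuous_radial/smooth_continuous/sf.
exists (fun x => x ord0 i * radial f1 x); last exact: CkM (Ck_coord _ _) (IH _ sf1).
by move=> x; apply: is_derive_radial_smooth => //; exact: smooth_continuous sf1.
Qed.

Lemma laplacian_radial (f f1 f2 : R -> R) : continuous f2 ->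
  (forall r : R, is_derive r 1 f (r * f1 r)) ->
  (forall r : R, is_derive r 1 f1 (r * f2 r)) ->
  laplacian (radial f) =
    radial (fun r => n%:R * f1 r + r ^+ 2 * f2 r) :> ('rV[R]_n -> R).
Proof.
move=> cf2 f' f1'; have cf1 (r : R) := is_derive1_continuous (f1' r).
apply/funext => x; rewrite /laplacian.
rewrite (eq_bigr (fun i => radial f1 x + x ord0 i ^+ 2 * radial f2 x)) => [|i _].
  rewrite big_split /= sumr_const card_ord -mulr_suml -sqr_enorm.
  by rewrite /radial [in RHS]mulr_natl.
rewrite (is_derive_partial (fun x => is_derive_radial_smooth cf1 f' x i)).
have D := is_deriveM (is_derive_coord x i i) (is_derive_radial_smooth cf2 f1' x i).
rewrite /partial [LHS](@derive_val _ _ _ _ _ _ _ D) eqxx /GRing.scale/=; ring.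
Qed.

(** With [f1] and [f2] of [laplacian_radial] the averages of weights [n-1] and
    [n+1], the identity [n f1 + r^2 f2 = g] is the integration by parts [wprim_by_parts] divided by
    [r^n]. *)
Lemma laplacian_invlap (a : R) (g : R -> R) : (0 < n)%N -> smooth 1 g ->
  laplacian (radial (fun r => a + invlap n g r)) = radial g :> ('rV[R]_n -> R).
Proof.
move=> n0 sg; have [g1 g' cg1] := sg; have cg := smooth_continuous sg.
have f' (r : R) : is_derive r 1 (fun r => a + invlap n g r) (r * avg n.-1 g r).
  have := is_deriveD (@is_derive_cst R R R a r 1) (is_derive_invlap n r cg).
  by rewrite add0r.
have f1' (r : R) : is_derive r 1 (avg n.-1 g) (r * avg n.+1 g1 r).
  by have := is_derive_avg n.-1 cg1 g' r; rewrite (prednK n0).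
rewrite (laplacian_radial (continuous_avg cg1) f' f1').
congr radial; apply/funext => r; have [->|r0] := eqVneq r 0.
  by rewrite expr0n mul0r addr0 /avg eqxx prednK// mulrC divfK// pnatr_eq0 -lt0n.
have rn : r ^+ n != 0 by rewrite expf_neq0.
apply: (mulfI rn).
have A1 : r ^+ n * avg n.-1 g r = wprim n.-1 g r.
  by have := avgE n.-1 g r; rewrite (prednK n0).
have A2 : r ^+ n.+2 * avg n.+1 g1 r = wprim n.+1 g1 r by exact: avgE.
rewrite mulrDr mulrCA A1 mulrA -exprD addn2 A2.
by have := wprim_by_parts n.-1 r cg1 g'; rewrite (prednK n0) => ->; ring.
Qed.

End VectorCalculus.

(** * Radial Laplacians of arbitrary radial functions *)

Section RadialLaplacian.
Context {R : realType} {n : nat}.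
Implicit Types (F G : 'rV[R]_n -> R) (x : 'rV[R]_n) (i : 'I_n).

Lemma laplacianZ (c : R) F : Ck 2 F ->
  laplacian (fun x => c * F x) = fun x => c * laplacian F x.
Proof.
move=> CF; apply/funext => x; rewrite /laplacian mulr_sumr.
apply: eq_bigr => i _.
have Z G : (forall x, is_derive x 'e_i G (partial i G x)) ->
    partial i (fun x => c * G x) = fun x => c * partial i G x.
  by move=> dG; exact: is_derive_partial.
have [dF CF1] := Ck_partial i CF; have [dF1 _] := Ck_partial i CF1.
by rewrite Z// Z.
Qed.

Lemma Ck_laplacian k F : Ck k.+2 F -> Ck k (laplacian F).
Proof.
move=> CF; apply: Ck_sum => i.
by have [_ CF1] := Ck_partial i CF; have [_] := Ck_partial i CF1.
Qed.

Lemma Ck_iter_laplacian k j F : Ck (2 * k + j) F -> Ck j (iter k (@laplacian R n) F).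
Proof.
elim: k j => [|k IH] j; first by [].
by rewrite mulnS addnC addnA => CF; apply/Ck_laplacian/IH; rewrite addn2 addnC in CF *.
Qed.

Lemma iter_neg_laplacian k F : Ck (2 * k) F ->
  iter k (@neg_laplacian R n) F = fun x => (-1) ^+ k * iter k (@laplacian R n) F x.
Proof.
elim: k => [_|k IH CF]; first by apply/funext => x; rewrite mul1r.
have CF' : Ck (2 * k + 2) F by rewrite -mulnSr.
rewrite iterS IH; last by apply: Ck_le CF'; rewrite leq_addr.
rewrite /neg_laplacian laplacianZ; last exact: Ck_iter_laplacian.
by apply/funext => x; rewrite iterS exprS mulN1r mulNr.
Qed.

Hypothesis hn : (0 < n)%N.
Local Notation e1 := ('e_(Ordinal hn) : 'rV[R]_n).

Lemma enorm_e1 (r : R) : enorm (r *: e1) = `|r|.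
Proof. exact: enorm_scale_delta. Qed.

Lemma enorm0_eq0 x : enorm x = 0 -> x = 0.
Proof. by move=> x0; apply/rowP => i; rewrite mxE enorm_eq0_coord. Qed.

Lemma is_derive_restrict_line G (r l : R) : is_derive (r *: e1) e1 G l ->
  is_derive r 1 (fun r : R => G (r *: e1)) l.
Proof.
move=> /is_derive_lineP dG; apply/(is_derive_lineP (V := R)).
by apply: is_derive_ext dG => h /=; rewrite scalerDl [h *: 1]mulr1.
Qed.

(** With [f r = F (r e_1)], [p = f'] and [q = f''], radiality gives
    [partial_i F x = x_i p |x| / |x|] for every [x], because [p 0 = 0] as [f] is
    even. Differentiating once more off the origin,
    [Delta F x = q |x| + (n-1) p |x| / |x|], which depends on [|x|] only and is
    the derivative of [r^(n-1) p] divided by [r^(n-1)]. *)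
Lemma laplacian_radial_C2 (v : R -> R) : Ck 2 (radial v : 'rV[R]_n -> R) ->
  let w r := laplacian (radial v) (r *: e1) in
  laplacian (radial v) = radial w :> ('rV[R]_n -> R) /\
  radial_lap n (fun r => radial v (r *: e1)) w.
Proof.
move=> CF w; set F := radial v in CF *.
pose i0 := Ordinal hn; pose f r := F (r *: e1).
pose p r := partial i0 F (r *: e1).
pose q r := partial i0 (partial i0 F) (r *: e1).
have [dF CF1] := Ck_partial i0 CF; have [dF1 _] := Ck_partial i0 CF1.
have df (r : R) : is_derive r 1 f (p r) by exact: is_derive_restrict_line.
have dp (r : R) : is_derive r 1 p (q r) by exact: is_derive_restrict_line.
have fE r : f r = v `|r| by rewrite /f /F /radial enorm_e1.
have FE : F = radial f.
  by apply/funext => x; rewrite /radial fE ger0_norm// enorm_ge0.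
(* [f] is even, so its derivative is odd. *)
have p0 : p 0 = 0.
  have := @is_derive1_comp R f -%R 0 _ _ _ (is_deriveNid (0 : R) 1).
  rewrite oppr0 => /(_ _ (df 0)) dfN.
  have : is_derive (0 : R) 1 f (p 0 * -1).
    by apply: is_derive_ext dfN => t /=; rewrite !fE normrN.
  move=> /(@derive_val _ _ _ _ _ _ _); rewrite (@derive_val _ _ _ _ _ _ _ (df 0)).
  by lra.
(* At the origin [g] takes the value [0], and the formula for the partial
   derivatives holds there because the coordinates vanish. *)
pose g r := p r / r.
have partialF i : partial i F = fun x => x ord0 i * radial g x.
  apply: is_derive_partial => x; have [x0|x0] := eqVneq (enorm x) 0.
    rewrite (enorm_eq0_coord i x0) mul0r -p0; apply/is_derive_lineP.
    apply: is_derive_ext (df 0) => h.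
    by rewrite fE /F /radial enorm_line x0 (enorm_eq0_coord i x0) mulr0 mul0r
      expr0n !add0r sqrtr_sqr.
  have := is_derive_radial i x0 (df (enorm x)); rewrite -FE.
  by move=> /is_derive_eq; apply; rewrite /radial /g; field.
pose L r := q r + n.-1%:R * p r / r.
have lapF x : enorm x != 0 -> laplacian F x = L (enorm x).
  move=> x0; set r := enorm x; have r0 : r != 0 := x0.
  have dg : is_derive r 1 g (q r / r - p r / r ^+ 2).
    have := is_deriveM (dp r) (is_deriveV (f := fun t : R => t) r0 (is_derive_id r 1)).
    by move=> /is_derive_eq; apply; rewrite /GRing.scale/=; field.
  rewrite /laplacian.
  rewrite (eq_bigr (fun i => g r + x ord0 i ^+ 2 * ((q r / r - p r / r ^+ 2) / r)))
    => [|i _].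
    rewrite big_split /= sumr_const card_ord -mulr_suml -sqr_enorm -/r /L.
    have -> : g r *+ n = (n.-1%:R + 1) * g r by rewrite natr1 prednK// mulr_natl.
    by rewrite /g; field.
  rewrite partialF.
  have D := is_deriveM (is_derive_coord x i i) (is_derive_radial i x0 dg).
  rewrite /partial [LHS](@derive_val _ _ _ _ _ _ _ D) eqxx /GRing.scale/= -/r.
  by rewrite /radial -/r; ring.
split.
  apply/funext => x; rewrite /w /radial; have [x0|x0] := eqVneq (enorm x) 0.
    by rewrite x0 scale0r (enorm0_eq0 x0).
  by rewrite !lapF ?enorm_e1 ?ger0_norm ?enorm_ge0.
exists p; split => //.
- by move=> r; apply: is_derive1_continuous (df r).
- by move=> r; apply: is_derive1_continuous (dp r).
- move=> r r0; have := is_deriveM (is_derive_Xn n.-1 r) (dp r).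
  move=> /is_derive_eq; apply; rewrite /w lapF ?enorm_e1 ?normr_eq0 ?gt_eqF//.
  rewrite gtr0_norm// /L /GRing.scale/=; case: n.-1 => [|j]; first by ring.
  by rewrite exprS; field; exact: lt0r_neq0.
Qed.

End RadialLaplacian.

(** * The initial value problem *)

Section GlobalSolutions.
Context {R : realType} (n : nat) (hn : (1 <= n)%N) (m : nat).
Hypotheses (hm1 : (1 <= m)%N) (hm : odd m).
Variable alpha : 'I_m -> R.

(** Each Laplacian of a solution up to order [m] is again radial, so the
    equation becomes a chain of radial equations; [m] odd turns
    [(- Delta)^m u = e^u] into [Delta^m u = - e^u]. *)
Lemma global_solution_radial_lap v : global_solution hn alpha v ->
  (forall k, (k < m)%N -> radial_lap n (iter_lap hn k v) (iter_lap hn k.+1 v)) /\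
  forall r, iter_lap hn m v r = - expR (iter_lap hn 0 v r).
Proof.
move=> [Cv eqv _ _]; set F := radial v in Cv eqv.
have C2 k : (k < m)%N -> Ck 2 (iter k (@laplacian R n) F).
  move=> km; apply: Ck_iter_laplacian; apply: Ck_le Cv.
  by rewrite -mulnSr leq_mul2l km orbT.
have iterF k : (k <= m)%N -> iter k (@laplacian R n) F = radial (iter_lap hn k v).
  elim: k => [_|k IH km].
    by apply/funext => x; rewrite /radial iter_lap0// enorm_ge0.
  have := C2 k km; rewrite (IH (ltnW km)) => /(laplacian_radial_C2 hn)[+ _].
  by rewrite -(IH (ltnW km)) -iterS.
split=> [k km|r].
  have := C2 k km; rewrite (iterF k (ltnW km)) => /(laplacian_radial_C2 hn)[_].
  by rewrite -(iterF k (ltnW km)).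
have := eqv (r *: 'e_(Ordinal hn)); rewrite iter_neg_laplacian//.
by rewrite -signr_odd hm mulN1r => <-; rewrite opprK.
Qed.

(** On [0, rho] both solutions are bounded, so the exponential is Lipschitz
    there, and the differences of the iterated Laplacians form a chain with zero
    initial values. Feeding the bound of the lowest one back into the top of the
    chain improves it to [M (K r^2)^j / j!] for every [j]. *)
Lemma global_solution_unique u v :
  global_solution hn alpha u -> global_solution hn alpha v ->
  forall r, 0 <= r -> v r = u r.
Proof.
move=> su sv rho rho0.
have [lu eu] := global_solution_radial_lap su.
have [lv ev] := global_solution_radial_lap sv.
pose d k r := iter_lap hn k u r - iter_lap hn k v r.
have cont (w : R -> R) : (forall k, (k < m)%N ->
    radial_lap n (iter_lap hn k w) (iter_lap hn k.+1 w)) ->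
    continuous (iter_lap hn 0 w).
  by move=> /(_ 0%N hm1)[w1 []].
have [Cu _ hCu] := continuous_bounded rho (cont u lu).
have [Cv _ hCv] := continuous_bounded rho (cont v lv).
have [M M0 hM] : exists2 M, 0 <= M & forall r : R, 0 <= r <= rho -> `|d 0%N r| <= M.
  by apply: continuous_bounded => x; apply: cvgB; [exact: cont|exact: cont].
pose C := Num.max Cu Cv.
pose K := expR C * rho ^+ (2 * m.-1).
have K0 : 0 <= K by rewrite mulr_ge0 ?expR_ge0 ?exprn_ge0.
have dM j (r : R) : 0 <= r <= rho ->
    `|d 0%N r| <= M * exp_coeff K j * r ^+ (2 * j).
  elim: j r => [|j IH] r hr.
    by rewrite muln0 expr0 mulr1 /exp_coeff /= expr0 fact0 divr1 mulr1 hM.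
  have [r0 _] := andP hr.
  have c0 : 0 <= expR C * (M * exp_coeff K j).
    by rewrite mulr_ge0 ?expR_ge0// mulr_ge0// exp_coeff_ge0.
  apply: le_trans (@chain_norm_le R n hn m.-1 d _ rho (2 * j) _ _ c0 _ r hr) _.
  - move=> i im; have {}im : (i < m)%N by rewrite -(prednK hm1).
    by apply: radial_lapB; [exact: lu|exact: lv].
  - move=> i im; have {}im : (i < m)%N by rewrite -(prednK hm1).
    rewrite /d; have := sol_value0 su (Ordinal im); have := sol_value0 sv (Ordinal im).
    by move=> /= -> ->; rewrite subrr.
  - move=> t /andP[t0 tr]; have ht : 0 <= t <= rho by rewrite !ltW.
    rewrite (prednK hm1) /d eu ev -opprD normrN.
    apply: le_trans (@expR_lipschitz _ C _ _ _ _) _.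
    + by rewrite le_max (le_trans (ler_norm _) (hCu t ht)).
    + by rewrite le_max (le_trans (ler_norm _) (hCv t ht)) orbT.
    by rewrite -[leRHS]mulrA ler_wpM2l ?expR_ge0// IH.
  - rewrite mulnS !addSn add0n ler_wpM2r ?exprn_ge0//.
    apply: le_trans (ler_wpM2l M0 (exp_coeff_step j K0)).
    by rewrite /K le_eqVlt; apply/orP; left; apply/eqP; ring.
have d0 : d 0%N rho = 0.
  apply/eqP; rewrite -normr_le0.
  have lim : M * exp_coeff (K * rho ^+ 2) j @[j --> \oo] --> 0.
    by rewrite -(mulr0 M); apply: cvgZr; exact: cvg_exp_coeff.
  apply: (cvgr_to_ge lim); near=> j.
  have := dM j rho; rewrite lexx rho0 => /(_ isT)/le_trans; apply.
  by rewrite exp_coeffMl -exprM -[leLHS]mulrA.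
have := d0; rewrite /d !iter_lap0// => /subr0_eq ->.
by [].
Unshelve. all: by end_near. Qed.

(** The fixed point is even, hence equal to [solve n s (- expR u)] as a radial
    function; each Laplacian removes one entry of [s]. *)
Lemma global_solution_exists : exists u, global_solution hn alpha u.
Proof.
pose s := [tuple alpha i | i < m].
have s_gt0 : (0 < size s)%N by rewrite size_tuple.
have [u cu uE] := @picard_fixpoint R n s hn s_gt0.
have su k : smooth k u by exact: smooth_picard_fixpoint cu uE.
pose g (r : R) := - expR (u r).
have sg k : smooth k g by exact/smoothN/smooth_expR.
have uE' : radial u = radial (solve n s g) :> ('rV[R]_n -> R).
  by rewrite {1}uE; exact: radial_comp_abs.
have lapu k : (k <= m)%N ->
    iter k (@laplacian R n) (radial u) = radial (solve n (drop k s) g).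
  elim: k => [_|k IH km]; first by rewrite drop0.
  rewrite iterS IH ?(ltnW km)// (drop_nth 0) ?size_tuple//=.
  apply: laplacian_invlap => //.
  have := smooth_solve n (drop k.+1 s) (sg 1%N).
  by apply: smooth_le; rewrite leq_addl.
have lap_smooth k : (k <= m)%N -> smooth 1 (solve n (drop k s) g).
  move=> km; have := smooth_solve n (drop k s) (sg 1%N).
  by apply: smooth_le; rewrite leq_addl.
have iter_lapE k r : (k <= m)%N -> iter_lap hn k u r = solve n (drop k s) g `|r|.
  by move=> km; rewrite /iter_lap lapu// /radial enorm_e1.
exists u; split.
- exact: Ck_radial.
- move=> x; rewrite iter_neg_laplacian; last exact: Ck_radial.
  rewrite lapu// -signr_odd hm mulN1r drop_oversize ?size_tuple//.
  by rewrite /radial /g /= opprK.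
- move=> k; rewrite iter_lapE ?(ltnW (ltn_ord k))// normr0.
  rewrite (drop_nth 0) ?size_tuple// solve0.
  by rewrite -tnth_nth tnth_mktuple.
- move=> k; have km := ltnW (ltn_ord k).
  have [f1 f' cf1] := lap_smooth k km.
  have [dh d0] := is_derive_comp_abs cf1 f' 0.
  rewrite mul0r in d0.
  move/cvg_ex: dh => [l hl]; have l0 : l = 0 by rewrite -d0; apply/esym/cvg_lim.
  rewrite l0 in hl; rewrite /right_derivative0.
  suff -> : (fun h : R => h^-1 * (iter_lap hn k u h - iter_lap hn k u 0)) =
      (fun h : R => h^-1 *: (((fun r : R => solve n (drop k s) g `|r|) \o shift 0)
        (h *: (1 : R)) - solve n (drop k s) g `|0 : R|)).
    exact: cvg_dnbhs_at_right hl.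
  by apply/funext => h; rewrite !iter_lapE //= [h *: 1]mulr1 addr0.
Qed.

End GlobalSolutions.

Theorem theorem2p1 (R : realType) (n : nat) (hn : (1 <= n)%N)
    (m : nat) (hm1 : (1 <= m)%N) (hm : odd m) (alpha : 'I_m -> R) :
  exists u : R -> R,
    global_solution hn alpha u /\
    forall v : R -> R, global_solution hn alpha v ->
      forall r : R, 0 <= r -> v r = u r.
Proof.
have [u su] := global_solution_exists hn hm1 hm alpha.
exists u; split=> // v sv r r0.
exact: (global_solution_unique hm1 hm su sv r0).
Qed.
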